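(* There is an absolute constant $c>0$ such that for every $\ell\ge 2$ and every weight vector $w\in(0,\infty)^\ell$ there is an online algorithm for the convex allocation problem in dimension $\ell$ with weights $w$ that is $c\log(\ell+1)$-competitive.
   Context: Allocation problem in dimension $\ell$ with weights $w=(w_1,\dots,w_\ell)\in(0,\infty)^\ell$: an algorithm maintains a point $x(t)$ in the simplex $\Delta^{\ell-1}=\{x\in[0,1]^\ell:\sum_{i=1}^\ell x_i=1\}$, starting from a given $x(0)$. At each time $t=1,2,\dots$ an adversary reveals a direction $r_t\in\{1,\dots,\ell\}$ and a non-increasing cost function $f_t:[0,1]\to\mathbb{R}_{\ge0}\cup\{\infty\}$; the algorithm then chooses $x(t)\in\Delta^{\ell-1}$ (an online algorithm chooses it knowing only the data revealed up to time $t$), paying movement cost $\sum_{i=1}^\ell w_i|x_i(t)-x_i(t-1)|$ and service cost $f_t(x_{r_t}(t))$. The goal is to minimize total cost. In the convex allocation problem every $f_t$ is additionally convex. An online algorithm is $\rho$-competitive if there is $b$ independent of the request sequence such that on every sequence its total cost is at most $\rho\cdot\mathrm{OPT}+b$, where $\mathrm{OPT}$ is the minimum total cost of any offline sequence of points serving the same sequence from the same starting point. *)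

(* Defs.v *)
From HB Require Import structures.
From mathcomp Require Import all_boot all_order all_algebra.
From mathcomp Require Import all_classical all_reals all_analysis.
Set Implicit Arguments. Unset Strict Implicit. Unset Printing Implicit Defensive.
Import Order.TTheory GRing.Theory Num.Theory.
Local Open Scope ring_scope.
Local Open Scope classical_set_scope.

Definition point (R : realType) (l : nat) := 'I_l -> R.

Definition in_simplex (R : realType) (l : nat) (x : point R l) : Prop :=
  (forall i, 0 <= x i <= 1) /\ \sum_(i < l) x i = 1.

(* Admissible cost functions of the convex allocation problem: defined on
   [0,1] (values outside [0,1] are irrelevant), nonnegative, possibly +oo,
   non-increasing and convex (with the extended-real convention 0 * +oo = 0). *)
Definition convex_cost (R : realType) (f : R -> \bar R) : Prop :=
  (forall x : R, 0 <= x <= 1 -> (0 <= f x)%E) /\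
  (forall x y : R, 0 <= x <= 1 -> 0 <= y <= 1 -> x <= y -> (f y <= f x)%E) /\
  (forall x y lam : R, 0 <= x <= 1 -> 0 <= y <= 1 -> 0 <= lam <= 1 ->
     (f (lam * x + (1 - lam) * y)%R <= lam%:E * f x + (1 - lam)%R%:E * f y)%E).

Definition request (R : realType) (l : nat) := ('I_l * (R -> \bar R))%type.

(* A request sequence of length n is given by reqs 0, ..., reqs (n-1)
   (reqs t is the request revealed at time t+1). *)
Definition valid_requests (R : realType) (l : nat) (reqs : nat -> request R l)
  (n : nat) : Prop :=
  forall t, (t < n)%N -> convex_cost (reqs t).2.

Definition move_cost (R : realType) (l : nat) (w : 'I_l -> R) (x y : point R l) : R :=
  \sum_(i < l) w i * `|y i - x i|.

(* Total cost of a trajectory X (X 0 is the starting point, X (t+1) = x(t+1))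
   on the first n requests. *)
Definition total_cost (R : realType) (l : nat) (w : 'I_l -> R)
  (reqs : nat -> request R l) (n : nat) (X : nat -> point R l) : \bar R :=
  (\sum_(0 <= t < n)
     ((move_cost w (X t) (X t.+1))%:E + (reqs t).2 (X t.+1 (reqs t).1)))%E.

Definition OPT (R : realType) (l : nat) (w : 'I_l -> R) (x0 : point R l)
  (reqs : nat -> request R l) (n : nat) : \bar R :=
  ereal_inf [set total_cost w reqs n X | X in
     [set X : nat -> point R l | X 0%N = x0 /\ forall t, in_simplex (X t)]].

(* A deterministic online algorithm: given the starting point and the
   requests revealed so far (r_1,f_1),...,(r_t,f_t), it outputs x(t). *)
Definition online_alg (R : realType) (l : nat) :=
  point R l -> seq (request R l) -> point R l.

Definition alg_traj (R : realType) (l : nat) (A : online_alg R l) (x0 : point R l)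
  (reqs : nat -> request R l) : nat -> point R l :=
  fun t => match t with
           | 0%N => x0
           | t'.+1 => A x0 [seq reqs i | i <- iota 0 t'.+1]
           end.

Definition competitive (R : realType) (l : nat) (w : 'I_l -> R)
  (A : online_alg R l) (rho : R) : Prop :=
  (forall x0 s, in_simplex (A x0 s)) /\
  forall x0 : point R l, in_simplex x0 ->
  exists b : R, forall (reqs : nat -> request R l) (n : nat),
    valid_requests reqs n ->
    (total_cost w reqs n (alg_traj A x0 reqs) <= rho%:E * OPT w x0 reqs n + b%:E)%E.

(* Main.v *)
(* The state is a matrix c of reals in [0,1] with nonincreasing rows, one row
   per coordinate and m + 1 layers, m = up_log 2 l. The algorithm plays the row
   means x_i = \sum_h p_h c_ih for geometric weights p_h proportional to 2^-h,
   so the layers act as thresholds of decreasing likelihood. The potential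
     12 \sum_i w_i \sum_h (c_ih - y_i)^+
        + 2 \sum_i w_i \sum_h p_h (y_i - c_ih)^+ - \sum_i w_i x_i
   is O(m)-Lipschitz in the offline point y for the movement cost. Two moves
   are combined.
   - Eviction, when \sum_i x_i > 1: shift the layers of every row i one place
     down at speed 1/w_i. Written on the differences c_h - c_(h+1), the first
     sum telescopes and drops at rate at least s = \sum_i c_i0 - 1 for every y
     in the simplex, while the geometric weights bound the movement rate
     by 3 s.
   - Raising row r under a cost g that is w_r-Lipschitz: c_h moves up by
     (g(c_h) - g(c_(h-1))) / w_r, with c_(-1) = 1. The harm to the first sum
     telescopes to g(y_r), and by Jensen the gain of the second one is at least
     (g(x_r) - g(y_r)) / 2.
   Evicting the mass created by raising yields
     movement + g(x_r) + change of potential <= 13 g(y_r) + epsilon.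
   A general cost f is replaced by its K-Lipschitz minorant, split in n equal
   slices; when K exceeds the price per unit of mass of a direct jump, a final
   jump to a near minimizer defining the minorant pays for itself. *)
Require Import Defs.
From HB Require Import structures.
From mathcomp Require Import all_boot all_order all_algebra.
From mathcomp Require Import all_classical all_reals all_analysis.
From mathcomp Require Import ring lra.
Set Implicit Arguments. Unset Strict Implicit.
Unset Printing Implicit Defensive.
Import Order.TTheory GRing.Theory Num.Theory.
Local Open Scope ring_scope.

(** * Positive parts of reals *)

Section PositivePart.
Variable R : realType.
Implicit Types x y a s : R.

Definition pos x := Num.max x 0.

Variant pos_spec x : R -> Prop :=
  | PosGe of 0 <= x : pos_spec x x
  | PosLt of x < 0 : pos_spec x 0.

Lemma posP x : pos_spec x (pos x).
Proof.
rewrite /pos; case: (leP x 0) => x0; last by constructor; apply: ltW.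
by case: (ltgtP x 0) x0 => // [?|->] _; constructor.
Qed.

Lemma pos_ge0 x : 0 <= pos x.
Proof. by case: posP. Qed.

Lemma pos_ge x : x <= pos x.
Proof. by case: posP => // /ltW. Qed.

Lemma pos_le0 x : x <= 0 -> pos x = 0.
Proof. by move=> x0; apply: max_r. Qed.

Lemma pos_ge0E x : 0 <= x -> pos x = x.
Proof. by move=> x0; apply: max_l. Qed.

Lemma pos_convex a x y : 0 <= a <= 1 ->
  pos ((1 - a) * x + a * y) <= (1 - a) * pos x + a * pos y.
Proof.
move=> /andP[a0 a1].
have h1 : (1 - a) * x <= (1 - a) * pos x
  by rewrite ler_wpM2l ?pos_ge// subr_ge0.
have h2 : a * y <= a * pos y by rewrite ler_wpM2l ?pos_ge.
have h3 : 0 <= (1 - a) * pos x by rewrite mulr_ge0 ?pos_ge0// subr_ge0.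
have h4 : 0 <= a * pos y by rewrite mulr_ge0 ?pos_ge0.
by case: posP => _; lra.
Qed.

Lemma pos_mono x y : x <= y -> pos x <= pos y.
Proof. by move=> xy; case: posP => ?; case: posP => ?; lra. Qed.

Lemma pos_diff x y : x <= y -> pos y - pos x <= y - x.
Proof. by move=> xy; case: posP => ?; case: posP => ?; lra. Qed.

Lemma pos_lip x y : `|pos x - pos y| <= `|x - y|.
Proof.
have [xy|/ltW yx] := leP x y.
  by rewrite distrC (distrC x) !ger0_norm ?subr_ge0 ?pos_mono// pos_diff.
by rewrite !ger0_norm ?subr_ge0 ?pos_mono// pos_diff.
Qed.

(** If some [a j] reaches [s], its truncated term alone equals [s]; otherwise truncation at [s]
    changes no positive part. *)
Lemma sum_min_pos (I : finType) (a : I -> R) s : 0 <= s ->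
  s <= \sum_i a i -> s <= \sum_i Num.min (pos (a i)) s.
Proof.
move=> s0 sa.
have nn i : 0 <= Num.min (pos (a i)) s by rewrite le_min pos_ge0.
have [/existsP[j sj]|/existsPn small] := boolP [exists j, s <= a j].
  rewrite (bigD1 j)//= min_r; last exact: le_trans (pos_ge _).
  by rewrite lerDl sumr_ge0.
apply: le_trans sa _; apply: ler_sum => i _; rewrite le_min pos_ge/=.
by have := small i; rewrite -ltNge => /ltW.
Qed.

End PositivePart.

(** The third clause is the Lipschitz bound; it keeps a raised layer from passing the old position
    of the layer above it. *)
Definition lip_cost (R : realType) (W : R) (g : R -> R) :=
  [/\ forall a, 0 <= a <= 1 -> 0 <= g a,
      forall a b, 0 <= a -> a <= b -> b <= 1 -> g b <= g a,
      forall a b, 0 <= a -> a <= b -> b <= 1 -> g a - g b <= W * (b - a) &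
      forall a b t, 0 <= a <= 1 -> 0 <= b <= 1 -> 0 <= t <= 1 ->
        g (t * a + (1 - t) * b) <= t * g a + (1 - t) * g b].

(** * A single row of layers: shifting down and raising *)

Section Layers.
Variables (R : realType) (p : nat -> R) (m : nat).
Hypothesis p_gt0 : forall h, 0 < p h.
Hypothesis p_half : forall h, p h = 2 * p h.+1.
Hypothesis p_sum1 : \sum_(h < m.+1) p h = 1.
Implicit Types (u v : nat -> R) (g : R -> R) (a y s W : R).

Definition avg u := \sum_(h < m.+1) p h * u h.
Definition excess u y := \sum_(h < m.+1) pos (u h - y).
Definition deficit u y := \sum_(h < m.+1) p h * pos (y - u h).

Let p_ge0 h : 0 <= p h. Proof. exact: ltW. Qed.

Lemma avg_const a : avg (fun=> a) = a.
Proof. by rewrite /avg -mulr_suml p_sum1 mul1r. Qed.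

Lemma avg_mono u v : (forall h, (h <= m)%N -> u h <= v h) -> avg u <= avg v.
Proof. by move=> uv; apply: ler_sum => h _; rewrite ler_wpM2l// uv// -ltnS. Qed.

Lemma avg_ge0 u : (forall h, 0 <= u h) -> 0 <= avg u.
Proof. by move=> u0; rewrite -[leLHS](avg_const 0); apply: avg_mono. Qed.

Lemma avg_le1 u : (forall h, u h <= 1) -> avg u <= 1.
Proof. by move=> u0; rewrite -[leRHS](avg_const 1); apply: avg_mono. Qed.

Lemma avgB u v : avg (fun h => u h - v h) = avg u - avg v.
Proof. by rewrite /avg -sumrB; apply: eq_bigr => h _; rewrite mulrBr. Qed.

Lemma avgZ a u : avg (fun h => a * u h) = a * avg u.
Proof. by rewrite /avg mulr_sumr; apply: eq_bigr => h _; rewrite mulrCA. Qed.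

Lemma avgD u v : avg (fun h => u h + v h) = avg u + avg v.
Proof. by rewrite /avg -big_split; apply: eq_bigr => h _ /=;
  rewrite mulrDr. Qed.

Lemma p_ge_last h : (h <= m)%N -> p m <= p h.
Proof.
elim: m => [|k IH]; first by rewrite leqn0 => /eqP ->.
rewrite leq_eqVlt => /predU1P[->//|/IH]; apply: le_trans.
by rewrite (p_half k) ler_peMl// ler1n.
Qed.

Lemma layer_le_avg u h : (forall k, 0 <= u k) -> (h <= m)%N ->
  p m * u h <= avg u.
Proof.
move=> u0 hm; rewrite /avg (bigD1 (inord h))//= inordK//.
rewrite -[leLHS]addr0 lerD ?ler_wpM2r ?p_ge_last//.
by apply: sumr_ge0 => k _; rewrite mulr_ge0.
Qed.

(** Since [p h = 2 * p h.+1], shifting the index doubles the average, up to the two boundary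
    terms. *)
Lemma avg_succ u :
  \sum_(h < m.+1) p h * u h.+1 = 2 * avg u - 2 * p 0%N * u 0%N + p m * u m.+1.
Proof.
rewrite big_ord_recr/= /avg big_ord_recl/=; congr (_ + _).
rewrite mulrDr mulrA addrAC subrr add0r mulr_sumr.
by apply: eq_bigr => h _; rewrite (p_half h) /bump/= mulrA.
Qed.

Lemma p0E : 2 * p 0%N = 1 + p m.
Proof.
have := avg_succ (fun=> 1); rewrite avg_const.
under eq_bigr do rewrite mulr1.
by rewrite p_sum1; lra.
Qed.

(** One explicit step of length [a] of the flow carrying each layer to the next one. *)
Definition evict a u h := (1 - a) * u h + a * u h.+1.

(** The geometric weights make the average fall at the rate of its gap to the top layer plus a
    boundary term, with no factor [m]. *)
Lemma avg_evict a u :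
  avg u - avg (evict a u) = a * ((u 0%N - avg u) + p m * (u 0%N - u m.+1)).
Proof.
have -> : avg (evict a u) =
    (1 - a) * avg u + a * (\sum_(h < m.+1) p h * u h.+1).
  rewrite avgD avgZ; congr (_ + _); rewrite /avg mulr_sumr.
  by apply: eq_bigr => h _; rewrite mulrCA.
by rewrite avg_succ p0E; ring.
Qed.

Lemma evict_between a u h : 0 <= a <= 1 -> u h.+1 <= u h ->
  u h.+1 <= evict a u h <= u h.
Proof. by move=> /andP[a0 a1] uh; rewrite /evict; apply/andP; split; nra. Qed.

(** Convexity of [pos] handles each layer; the differences of consecutive layers telescope to the
    top and bottom ones. *)
Lemma excess_evict a u y : 0 <= a <= 1 ->
  excess (evict a u) y <=
  excess u y - a * (pos (u 0%N - y) - pos (u m.+1 - y)).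
Proof.
move=> a01.
have -> : pos (u 0%N - y) - pos (u m.+1 - y) =
    \sum_(h < m.+1) (pos (u h - y) - pos (u h.+1 - y)).
  elim: m => [|k IH]; first by rewrite big_ord_recr big_ord0/= add0r.
  by rewrite big_ord_recr/= -IH; ring.
rewrite /excess mulr_sumr -sumrB; apply: ler_sum => h _.
have -> : evict a u h - y = (1 - a) * (u h - y) + a * (u h.+1 - y).
  by rewrite /evict; ring.
by apply: le_trans (pos_convex _ _ a01) _; lra.
Qed.

Lemma excess_mono u v y : (forall h, (h <= m)%N -> v h <= u h) ->
  excess v y <= excess u y.
Proof.
by move=> vu; apply: ler_sum => h _; rewrite pos_mono// lerB// vu// -ltnS.
Qed.

Lemma deficit_drop u v y : (forall h, (h <= m)%N -> v h <= u h) ->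
  deficit v y - deficit u y <= avg u - avg v.
Proof.
move=> vu'; have vu (h : 'I_m.+1) : v h <= u h by rewrite vu'// -ltnS.
rewrite /deficit /avg -!sumrB; apply: ler_sum => h _.
rewrite -!mulrBr ler_wpM2l//.
have := @pos_diff _ (y - u h) (y - v h) (lerB (lexx y) (vu h)).
by have := vu h; lra.
Qed.

(** A virtual layer at 1 precedes the top one, so that [raise] moves each layer by the drop of [g]
    across the gap above it, divided by [W]. *)
Definition prev u h := if h is k.+1 then u k else 1.
Definition raise g W u h := u h + (g (u h) - g (prev u h)) / W.

Section Raise.
Variables (g : R -> R) (W : R) (u : nat -> R).
Hypothesis W_gt0 : 0 < W.
Hypothesis g_ge0 : forall a, 0 <= a <= 1 -> 0 <= g a.
Hypothesis g_mono : forall a y, 0 <= a -> a <= y -> y <= 1 -> g y <= g a.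
Hypothesis g_lip : forall a y, 0 <= a -> a <= y -> y <= 1 ->
  g a - g y <= W * (y - a).
Hypothesis u01 : forall h, 0 <= u h <= 1.
Hypothesis u_mono : forall h, u h.+1 <= u h.

Let u_ge0 h : 0 <= u h. Proof. by case/andP: (u01 h). Qed.
Let u_le1 h : u h <= 1. Proof. by case/andP: (u01 h). Qed.
Let prev_le1 h : prev u h <= 1. Proof. by case: h => /=. Qed.
Let u_prev h : u h <= prev u h. Proof. by case: h => /=. Qed.

Lemma raise_ge h : u h <= raise g W u h.
Proof. by rewrite lerDl divr_ge0 ?(ltW W_gt0)// subr_ge0 g_mono. Qed.

Lemma raise_le_prev h : raise g W u h <= prev u h.
Proof. by rewrite /raise -lerBrDl ler_pdivrMr// mulrC g_lip. Qed.

Lemma raise01 h : 0 <= raise g W u h <= 1.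
Proof.
by rewrite (le_trans (u_ge0 h) (raise_ge h)) (le_trans (raise_le_prev h)).
Qed.

Lemma raise_mono h : raise g W u h.+1 <= raise g W u h.
Proof. exact: le_trans (raise_le_prev h.+1) (raise_ge h). Qed.

Let WraiseE h : W * (raise g W u h - u h) = g (u h) - g (prev u h).
Proof. by rewrite /raise addrAC subrr add0r mulrC divfK ?gt_eqF. Qed.

(** Only the climb above [y] counts. It is bounded by the difference of [g (max a y)] between a
    layer and the one above; these differences telescope to at most [g y]. *)
Lemma excess_raise y : 0 <= y <= 1 -> W * (excess (raise g W u) y - excess u
  y) <= g y.
Proof.
move=> /andP[y0 y1].
pose G a := g (Num.max a y).
have step h : W * (pos (raise g W u h - y) - pos (u h - y)) <=
              G (u h) - G (prev u h).
  have E := WraiseE h; have R1 := raise_ge h; have R2 := raise_le_prev h.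
  rewrite /G; have [uy|yu] := leP (u h) y; last first.
    rewrite max_l ?(le_trans (ltW yu))// !pos_ge0E ?subr_ge0 ?(ltW yu)//;
      first lra.
    exact: le_trans (ltW yu) R1.
  rewrite (@pos_le0 _ (u h - y)) ?subr_le0// subr0.
  have [py|yp] := leP (prev u h) y.
    by rewrite pos_le0 ?subr_le0 ?(le_trans R2)// subrr mulr0.
  have L := g_lip (u_ge0 h) uy y1.
  have M := g_mono y0 (ltW yp) (prev_le1 h).
  by case: posP => _; lra.
rewrite /excess -sumrB mulr_sumr.
apply: (@le_trans _ _ (\sum_(h < m.+1) (G (u h) - G (prev u h)))).
  by apply: ler_sum => h _.
have -> : \sum_(h < m.+1) (G (u h) - G (prev u h)) = G (u m) - G 1.
  elim: m => [|k IH]; first by rewrite big_ord_recr big_ord0/= add0r.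
  by rewrite big_ord_recr/= IH; ring.
have G1 : 0 <= G 1 by rewrite /G g_ge0// max_l// lexx ler01.
have : G (u m) <= g y.
  by rewrite /G g_mono// ?le_max ?lexx ?orbT// ge_max y1 u_le1.
by lra.
Qed.

Hypothesis g_convex : forall a y t, 0 <= a <= 1 -> 0 <= y <= 1 -> 0 <= t <= 1 ->
  g (t * a + (1 - t) * y) <= t * g a + (1 - t) * g y.

(* Stated for unnormalized weights to go through by induction on n. *)
Lemma jensen (n : nat) (q : nat -> R) : (forall h, 0 < q h) ->
  let s := \sum_(h < n.+1) q h in
  g ((\sum_(h < n.+1) q h * u h) / s) * s <= \sum_(h < n.+1) q h * g (u h).
Proof.
move=> q0 /=; elim: n => [|n IH].
  rewrite !big_ord_recr !big_ord0/= !add0r mulrAC divff ?gt_eqF// mul1r.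
  by rewrite mulrC.
rewrite !(big_ord_recr n.+1)/=.
set s := \sum_(h < n.+1) q h in IH *; set t := \sum_(h < n.+1) _ * u h in IH *.
have s0 : 0 < s.
  rewrite /s big_ord_recr/= ltr_wpDl// sumr_ge0// => h _; exact: ltW.
have Q := q0 n.+1.
have sq : 0 < s + q n.+1 by rewrite addr_gt0.
have ts : 0 <= t / s <= 1.
  rewrite divr_ge0 ?(ltW s0)//; last first.
    by apply: sumr_ge0 => h _; rewrite mulr_ge0// ltW.
  rewrite ler_pdivrMr// mul1r /t /s; apply: ler_sum => h _.
  by rewrite ler_piMr// ltW.
have th : 0 <= s / (s + q n.+1) <= 1.
  by rewrite divr_ge0 ?(ltW s0) ?(ltW sq)//= ler_pdivrMr// mul1r lerDl ltW.
have := g_convex ts (u01 n.+1) th.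
have -> : s / (s + q n.+1) * (t / s) + (1 - s / (s + q n.+1)) * u n.+1 =
   (t + q n.+1 * u n.+1) / (s + q n.+1) by field; rewrite !gt_eqF.
rewrite -(ler_pM2r sq) => /le_trans; apply.
rewrite (_ : _ * (s + q n.+1) = g (t / s) * s + q n.+1 * g (u n.+1)).
  by rewrite lerD2r.
by field; rewrite gt_eqF.
Qed.

Lemma jensen_avg : g (avg u) <= \sum_(h < m.+1) p h * g (u h).
Proof. by have /= := jensen m p_gt0; rewrite p_sum1 divr1 mulr1. Qed.

(** With [B a = g (min a y) - g y], layer [h] gains at least [B (u h) - B (prev u h)]. As the
    weights halve and [B 1 = 0], the subtracted terms amount to at most half of the average of
    [B (u h)], and Jensen bounds that average below by [g (avg u) - g y]. *)
Lemma deficit_raise y : 0 <= y <= 1 ->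
  g (avg u) - g y <= 2 * (W * (deficit u y - deficit (raise g W u) y)).
Proof.
move=> /andP[y0 y1].
pose B a := g (Num.min a y) - g y.
have B_ge0 h : 0 <= B (u h).
  by rewrite subr_ge0 g_mono// ?ge_min ?lexx ?orbT// le_min u_ge0.
have step h : p h * (B (u h) - B (prev u h)) <=
   p h * (W * (pos (y - u h) - pos (y - raise g W u h))).
  rewrite ler_wpM2l//.
  have E := WraiseE h; have R1 := raise_ge h; have R2 := raise_le_prev h.
  rewrite /B; have [uy|yu] := leP (u h) y; last first.
    rewrite min_r ?(le_trans (ltW yu))// !pos_le0 ?subr_le0 ?(ltW yu)//;
      first lra.
    exact: le_trans (ltW yu) R1.
  rewrite (@pos_ge0E _ (y - u h)) ?subr_ge0//.
  have [py|yp] := leP (prev u h) y.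
    by rewrite pos_ge0E ?subr_ge0 ?(le_trans R2)//; lra.
  have L := g_lip (u_ge0 h) uy y1.
  have M := g_mono y0 (ltW yp) (prev_le1 h).
  by case: posP => _; lra.
have -> : W * (deficit u y - deficit (raise g W u) y) =
  \sum_(h < m.+1) p h * (W * (pos (y - u h) - pos (y - raise g W u h))).
  rewrite /deficit -sumrB mulr_sumr; apply: eq_bigr => h _; ring.
apply: le_trans (_ : 2 * \sum_(h < m.+1) p h * (B (u h) - B (prev u h)) <= _).
  2: by rewrite ler_pM2l// ler_sum.
have B1 : B 1 = 0 by rewrite /B min_r// subrr.
have half : 2 * \sum_(h < m.+1) p h * B (prev u h) <= \sum_(h < m.+1) p h * B
  (u h).
  rewrite big_ord_recl/= B1 mulr0 add0r mulr_sumr big_ord_recr/=.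
  rewrite -[leLHS]addr0 lerD ?mulr_ge0//.
  by apply: ler_sum => h _; rewrite (p_half h) /bump/= mulrA.
have J : g (avg u) - g y <= \sum_(h < m.+1) p h * B (u h).
  apply: le_trans (lerB jensen_avg (lexx _)) _.
  rewrite -[X in _ - X]mul1r -p_sum1 mulr_suml -sumrB; apply: ler_sum => h _.
  rewrite -mulrBr ler_wpM2l// lerB// g_mono// ?ge_min ?lexx// le_min u_ge0//.
under eq_bigr do rewrite mulrBr.
by rewrite sumrB mulrBr; lra.
Qed.

End Raise.
End Layers.

(** * The matrix of layers, its potential, and eviction *)

Section Eviction.
Variables (R : realType) (p : nat -> R) (m l : nat) (w : 'I_l -> R).
Hypothesis p_gt0 : forall h, 0 < p h.
Hypothesis p_half : forall h, p h = 2 * p h.+1.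
Hypothesis p_sum1 : \sum_(h < m.+1) p h = 1.
Hypothesis p_last : l%:R * p m <= 1.
Hypothesis w_gt0 : forall i, 0 < w i.
Hypothesis l_gt0 : (0 < l)%N.

Definition state := 'I_l -> nat -> R.
Implicit Types (c : state) (x y : Defs.point R l).

Definition layered c := forall i h, 0 <= c i h <= 1 /\ c i h.+1 <= c i h.
Definition mean c : Defs.point R l := fun i => avg p m (c i).
Definition mass c := \sum_(i < l) mean c i.
Definition weigh x := \sum_(i < l) w i * x i.
Definition total_excess c y := \sum_(i < l) w i * excess m (c i) (y i).
Definition total_deficit c y := \sum_(i < l) w i * deficit p m (c i) (y i).
(* 2: the gain of the deficit when raising is half of g(x_r) - g(y_r).
   12 = 3 * (1 + 2 + 1): a drop of the excess pays for a third of the eviction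
   movement, which occurs as a cost, in twice the deficit and in - weigh. *)
Definition potential c y :=
  12 * total_excess c y + 2 * total_deficit c y - weigh (mean c).

(** The drop of the weighted mean is the movement cost; the excess pays for it against every offline
    point at once. The relation is transitive, so small steps chain. *)
Definition evicts c c' :=
  [/\ layered c', forall i h, (h <= m)%N -> c' i h <= c i h &
      forall y, in_simplex y -> weigh (mean c) - weigh (mean c') <=
                                3 * (total_excess c y - total_excess c' y)].

Lemma layered_noninc c i h k : layered c -> (h <= k)%N -> c i k <= c i h.
Proof.
move=> Lc; elim: k => [|k IH]; first by rewrite leqn0 => /eqP ->.
by rewrite leq_eqVlt => /predU1P[->//|/IH]; apply: le_trans; case: (Lc i k).
Qed.

Lemma mean_le c c' i : (forall j h, (h <= m)%N -> c' j h <= c j h) ->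
  mean c' i <= mean c i.
Proof. by move=> cc; apply: avg_mono => // h; apply: cc. Qed.

Lemma mean_le_top c i : layered c -> mean c i <= c i 0%N.
Proof.
move=> Lc; rewrite -[leRHS](avg_const p_sum1).
by apply: avg_mono => // h _; apply: layered_noninc.
Qed.

Lemma mean01 c i : layered c -> 0 <= mean c i <= 1.
Proof.
by move=> Lc; rewrite avg_ge0 ?avg_le1// => h; case: (Lc i h) => /andP[].
Qed.

(** [tau e] is the duration of one eviction step, short enough to lose at most [e] of mass;
    [kappa e] is a guaranteed loss, which bounds the number of steps. *)
Let tau (e : R) := e / (3 * l%:R * \sum_(i < l) (w i)^-1).
Let kappa e := tau e / (\sum_(i < l) w i) * p m * e.

Let l_pos : 0 < l%:R :> R. Proof. by rewrite ltr0n. Qed.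

Let le_wsum i : w i <= \sum_(j < l) w j.
Proof. by rewrite (bigD1 i)//= lerDl sumr_ge0// => j _; apply: ltW. Qed.

Let le_winvsum i : (w i)^-1 <= \sum_(j < l) (w j)^-1.
Proof. by rewrite (bigD1 i)//= lerDl sumr_ge0// => j _;
  rewrite invr_ge0 ltW. Qed.

Let wsum_gt0 : 0 < \sum_(j < l) w j.
Proof. exact: lt_le_trans (w_gt0 (Ordinal l_gt0)) (le_wsum _). Qed.

Let winvsum_gt0 : 0 < \sum_(j < l) (w j)^-1.
Proof.
by apply: lt_le_trans (le_winvsum (Ordinal l_gt0)); rewrite invr_gt0.
Qed.

Let tau_gt0 (e : R) : 0 < e -> 0 < tau e.
Proof. by move=> e0; rewrite divr_gt0// !mulr_gt0. Qed.

Let kappa_gt0 (e : R) : 0 < e -> 0 < kappa e.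
Proof. by move=> e0; rewrite mulr_gt0// mulr_gt0// divr_gt0// tau_gt0. Qed.

(** Let [s] be the amount by which the top layers exceed 1 in total. The movement is [tau e] times
    the sum of the rates [D i], at most [3 * tau e * s]. The tops exceed any simplex point [y] by
    [s] in total, so the excess drops by at least [tau e * s]. *)
Lemma evict_step c (e : R) : layered c -> 0 < e <= 1 -> 1 + e <= mass c ->
  exists c', [/\ evicts c c', 1 <= mass c' & mass c' <= mass c - kappa e].
Proof.
move=> Lc /andP[e0 e1] Me.
have t0 := tau_gt0 e0.
set s := \sum_(i < l) c i 0%N - 1.
have cge0 i h : 0 <= c i h by case: (Lc i h) => /andP[].
have cle1 i h : c i h <= 1 by case: (Lc i h) => /andP[].
have Ms : mass c <= 1 + s.
  by rewrite /s addrC subrK; apply: ler_sum => i _; apply: mean_le_top.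
have s0 : 0 < s by lra.
have sl : s <= l%:R.
  apply: (@le_trans _ _ (\sum_(i < l) c i 0%N)); first by rewrite /s; lra.
  by rewrite -[X in X%:R]card_ord -sumr_const ler_sum.
(* Continuing row i below layer m by its tail restricts the shift to the top
   part of width s of the row, so that the last layers, of total weight
   l * p m <= 1, do not move faster than s. *)
pose tail i := Num.min (c i m) (Num.max 0 (c i 0%N - s)).
pose ext i h := if (h <= m)%N then c i h else tail i.
have ext0 i : ext i 0%N = c i 0%N by [].
have extS i : ext i m.+1 = tail i by rewrite /ext ltnn.
have avg_ext i : avg p m (ext i) = mean c i.
  by apply: eq_bigr => h _; rewrite /ext -ltnS ltn_ord.
have over_ext i (y : R) : excess m (ext i) y = excess m (c i) y.
  by apply: eq_bigr => h _; rewrite /ext -ltnS ltn_ord.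
have tail_ge0 i : 0 <= tail i by rewrite le_min cge0 le_max lexx.
have tail_le i h : (h <= m)%N -> tail i <= c i h.
  by move=> hm; rewrite ge_min layered_noninc.
have Lext : layered ext.
  move=> i h; rewrite /ext; split.
    case: ifP => _; first by rewrite cge0 cle1.
    by rewrite tail_ge0 (le_trans (tail_le _ _ (leq0n m))).
  case: ltnP => hm; first by rewrite (ltnW hm); case: (Lc i h).
  by case: ifP => // h'; apply: tail_le.
have a01 i : 0 <= tau e / w i <= 1.
  rewrite divr_ge0 ?(ltW t0) ?(ltW (w_gt0 i))//=.
  apply: (@le_trans _ _ (tau e * \sum_(j < l) (w j)^-1)).
    by rewrite ler_pM2l.
  rewrite /tau invfM mulrA mulfVK ?gt_eqF// ler_pdivrMr ?mulr_gt0// mul1r.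
  have : 1 <= l%:R :> R by rewrite ler1n.
  lra.
pose D i := (c i 0%N - mean c i) + p m * (c i 0%N - tail i).
pose c' i := evict (tau e / w i) (ext i).
have between i h := evict_between (a01 i) (Lext i h).2.
have c'le i h : (h <= m)%N -> c' i h <= c i h.
  by move=> hm; have /andP[_] := between i h; rewrite {2}/ext hm.
have drop i : mean c i - mean c' i = tau e / w i * D i.
  by rewrite -{1}avg_ext avg_evict// extS ext0 avg_ext.
(* Either the tail is the last layer, whose gap to the top, times [p m], is at most the average gap,
   or the tail lies within [s] of the top. *)
have D_le i : D i <= 2 * (c i 0%N - mean c i) + p m * s.
  have : p m * (c i 0%N - c i m) <= c i 0%N - mean c i.
    rewrite -[X in _ <= X - _](avg_const p_sum1) -avgB.
    apply: (layer_le_avg p_gt0 p_half (u := fun h => c i 0%N - c i h)) => // k.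
    by rewrite subr_ge0 layered_noninc.
  have pm := p_gt0 m; rewrite /D /tail.
  have [h1|h1] := leP (c i m) (Num.max 0 (c i 0%N - s)); first by nra.
  have h2 : c i 0%N - s <= Num.max 0 (c i 0%N - s) by rewrite le_max lexx orbT.
  have := mean_le_top i Lc; nra.
(* The gaps between top and mean sum to at most [s] because the mass is at least 1; the boundary
   terms do because [l * p m <= 1]. *)
have sumD : \sum_(i < l) D i <= 3 * s.
  apply: (@le_trans _ _ (\sum_(i < l) (2 * (c i 0%N - mean c i) + p m * s))).
    by apply: ler_sum.
  rewrite big_split/= -mulr_sumr sumrB sumr_const card_ord -[_ *+ l]mulr_natl
    mulrA.
  have : l%:R * p m * s <= s by rewrite ler_piMl// ltW.
  by rewrite -/(mass c) -/s; move: Me; rewrite /s; lra.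
(* A tail above [y] is positive, hence at least [s] below the top; a tail below [y] subtracts
   nothing. *)
have gain i (y : R) : 0 <= y -> Num.min (pos (c i 0%N - y)) s <=
    pos (c i 0%N - y) - pos (tail i - y).
  move=> y0; have [ty|yt] := leP (tail i) y.
    by rewrite (@pos_le0 _ (tail i - y)) ?subr_le0// subr0 ge_min lexx.
  have : tail i <= c i 0%N - s.
    have h1 : tail i <= Num.max 0 (c i 0%N - s) by rewrite ge_min lexx orbT.
    have := lt_le_trans (le_lt_trans y0 yt) h1.
    by rewrite lt_max ltxx/= => /ltW h0; rewrite (max_r h0) in h1.
  by move=> h; rewrite !pos_ge0E ?subr_ge0; [rewrite ge_min; apply/orP; right;
    lra|lra|lra].
have a_ge0 i : 0 <= tau e / w i by case/andP: (a01 i).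
(* Comparison with the point 0 instead of [y] bounds the loss of mass from below. *)
have sumDge : p m * s <= \sum_(i < l) D i.
  apply: (@le_trans _ _ (\sum_(i < l) p m * Num.min (pos (c i 0%N - 0)) s)).
    rewrite -mulr_sumr ler_pM2l// sum_min_pos ?(ltW s0)//.
    by under eq_bigr do rewrite subr0; rewrite /s; lra.
  apply: ler_sum => i _; rewrite -[leLHS]add0r lerD ?subr_ge0 ?mean_le_top//.
  rewrite ler_pM2l// (le_trans (gain i 0 (lexx _)))// !subr0.
  by rewrite !pos_ge0E.
have D_ge0 i : 0 <= D i.
  rewrite addr_ge0 ?subr_ge0 ?mean_le_top// mulr_ge0 ?(ltW (p_gt0 m))//.
  by rewrite subr_ge0 tail_le.
have mass_drop : mass c - mass c' = \sum_(i < l) tau e / w i * D i.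
  by rewrite /mass -sumrB; apply: eq_bigr => i _; rewrite drop.
exists c'; split.
- split=> //.
    move=> i h; split.
      have /andP[h1 h2] := between i h.
      rewrite (le_trans _ h1) ?(le_trans h2)//=;
        first by case/andP: (Lext i h).1.
      by case/andP: (Lext i h.+1).1.
    by have /andP[h1 _] := between i h; have /andP[_ h2] := between i h.+1;
       apply: le_trans h1.
  move=> y [y01 y1].
  have -> : weigh (mean c) - weigh (mean c') = tau e * \sum_(i < l) D i.
    rewrite /weigh -sumrB mulr_sumr; apply: eq_bigr => i _.
    by rewrite -mulrBr drop mulrA mulrCA divff ?gt_eqF// mulr1.
  apply: (@le_trans _ _ (3 * (tau e * s))).
    by rewrite mulrCA ler_pM2l.
  rewrite ler_pM2l//.
  apply: (@le_trans _ _ (\sum_(i < l) tau e * Num.min (pos (c i 0%N - y i)) s)).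
    rewrite -mulr_sumr ler_pM2l// sum_min_pos ?(ltW s0)//.
    by rewrite sumrB y1.
  rewrite /total_excess -sumrB; apply: ler_sum => i _.
  have /andP[yi _] := y01 i.
  have E : w i * (tau e / w i) = tau e by rewrite mulrCA divff ?mulr1 ?gt_eqF.
  have := excess_evict m (ext i) (y i) (a01 i); rewrite extS ext0 over_ext.
  move=> /(ler_wpM2l (ltW (w_gt0 i))).
  rewrite mulrBr (mulrA (w i) (tau e / w i)) E -/(c' i).
  have := ler_wpM2l (ltW t0) (gain i (y i) yi); lra.
- suff : mass c - mass c' <= e by lra.
  rewrite mass_drop.
  apply: (@le_trans _ _ (\sum_(i < l) tau e * (\sum_(j < l) (w j)^-1) * D i)).
    by apply: ler_sum => i _; rewrite ler_wpM2r// ler_pM2l.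
  rewrite -mulr_sumr.
  apply: (@le_trans _ _ (tau e * (\sum_(j < l) (w j)^-1) * (3 * l%:R))).
    rewrite ler_wpM2l//; first by rewrite mulr_ge0 ?(ltW t0) ?(ltW winvsum_gt0).
    by apply: le_trans sumD _; rewrite ler_pM2l.
  rewrite /tau le_eqVlt; apply/orP; left; apply/eqP; field.
  by rewrite !gt_eqF.
- suff : kappa e <= mass c - mass c' by lra.
  rewrite mass_drop.
  apply: (@le_trans _ _ (\sum_(i < l) tau e / (\sum_(j < l) w j) * D i)).
    rewrite -mulr_sumr.
    have -> : kappa e = tau e / (\sum_(j < l) w j) * (p m * e) by rewrite mulrA.
    rewrite ler_pM2l; last by rewrite mulr_gt0 ?invr_gt0.
    by apply: le_trans sumDge; rewrite ler_pM2l//; lra.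
  apply: ler_sum => i _; rewrite ler_wpM2r// ler_pM2l//.
  by rewrite lef_pV2 ?posrE.
Qed.

Lemma evicts_trans c1 c2 c3 : evicts c1 c2 -> evicts c2 c3 -> evicts c1 c3.
Proof.
move=> [L2 le12 d12] [L3 le23 d23]; split=> // [i h hm|y yD].
  exact: le_trans (le23 i h hm) (le12 i h hm).
by have := d12 y yD; have := d23 y yD; lra.
Qed.

Lemma evict_until c (e : R) : layered c -> 0 < e <= 1 -> 1 <= mass c ->
  exists c', [/\ evicts c c', 1 <= mass c' & mass c' <= 1 + e].
Proof.
move=> Lc e01 Mc; have /andP[e0 _] := e01.
have loop n : exists c', [/\ evicts c c', 1 <= mass c' &
    mass c' <= 1 + e \/ mass c' <= mass c - n%:R * kappa e].
  elim: n => [|n [c' [Ec' M1 [M2|M2]]]].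
  - exists c; split=> //; last by right; rewrite mul0r subr0.
    by split=> // y _; rewrite !subrr mulr0.
  - by exists c'; split=> //; left.
  have [?|/ltW M3] := leP (mass c') (1 + e); first by exists c'; split=> //;
    left.
  have [Lc' _ _] := Ec'.
  have [c2 [E2 M4 M5]] := evict_step Lc' e01 M3.
  exists c2; split=> //; first exact: evicts_trans E2.
  by right; rewrite -natr1; lra.
(* Each unfinished step removes at least [kappa e], so after this many steps the mass would be
   negative. *)
have [c' [Ec' M1 M2]] := loop (Num.bound (mass c / kappa e)).
exists c'; split=> //; case: M2 => // M2.
have : mass c / kappa e < (Num.bound (mass c / kappa e))%:R.
  by apply: archi_boundP; rewrite divr_ge0 ?(ltW (kappa_gt0 e0))//; lra.
rewrite ltr_pdivrMr ?kappa_gt0// => h; lra.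
Qed.

Lemma move_cost_triangle x y z :
  move_cost w x z <= move_cost w x y + move_cost w y z.
Proof.
rewrite /move_cost -big_split; apply: ler_sum => i _ /=.
by rewrite -mulrDr ler_pM2l// [leRHS]addrC ler_distD.
Qed.

Lemma move_cost_le x y : (forall i, x i <= y i) ->
  move_cost w x y = weigh y - weigh x.
Proof.
move=> xy; rewrite /weigh -sumrB; apply: eq_bigr => i _.
by rewrite -mulrBr ger0_norm// subr_ge0.
Qed.

Lemma move_cost_sym x y : move_cost w x y = move_cost w y x.
Proof. by apply: eq_bigr => i _; rewrite distrC. Qed.

Lemma sum_update (F G : 'I_l -> R) r : (forall i, i != r -> F i = G i) ->
  \sum_i F i - \sum_i G i = F r - G r.
Proof.
move=> FG; rewrite -sumrB (bigD1 r)//= big1 ?addr0// => i ir.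
by rewrite FG// subrr.
Qed.

Lemma total_excess_mono c c' y :
  (forall i h, (h <= m)%N -> c' i h <= c i h) ->
  total_excess c' y <= total_excess c y.
Proof.
by move=> cc; apply: ler_sum => i _; rewrite ler_pM2l// excess_mono// => h;
  apply: cc.
Qed.

Lemma total_deficit_drop c c' y :
  (forall i h, (h <= m)%N -> c' i h <= c i h) ->
  total_deficit c' y - total_deficit c y <= weigh (mean c) - weigh (mean c').
Proof.
move=> cc; rewrite -!sumrB; apply: ler_sum => i _.
by rewrite -!mulrBr ler_pM2l// deficit_drop// => h; apply: cc.
Qed.

(** Eviction stops slightly above mass 1; scaling restores mass 1 exactly, at a cost proportional to
    the surplus that goes into the additive error. *)
Definition normalize c : state := fun i h => c i h / mass c.

Lemma mean_normalize c i : mean (normalize c) i = mean c i / mass c.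
Proof.
by rewrite /mean mulrC -avgZ; apply: eq_bigr => h _;
  rewrite /normalize (mulrC (c i h)).
Qed.

Lemma mass_normalize c : 0 < mass c -> mass (normalize c) = 1.
Proof.
move=> M0; rewrite /mass; under eq_bigr do rewrite mean_normalize.
by rewrite -mulr_suml divff// gt_eqF.
Qed.

Lemma normalize_le c i h : 1 <= mass c -> layered c -> normalize c i h <= c i h.
Proof.
move=> M1 Lc; have M0 : 0 < mass c by lra.
by rewrite ler_pdivrMr// ler_peMr//; case: (Lc i h) => /andP[].
Qed.

Lemma normalize_layered c : 1 <= mass c -> layered c -> layered (normalize c).
Proof.
move=> M1 Lc i h; have M0 : 0 < mass c by lra.
have /andP[c0 c1] := (Lc i h).1; split.
  by rewrite divr_ge0 ?(ltW M0)//= (le_trans (normalize_le _ _ M1 Lc)).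
by rewrite ler_pM2r ?invr_gt0//; case: (Lc i h).
Qed.

Lemma weigh_normalize c : 1 <= mass c -> layered c ->
  weigh (mean c) - weigh (mean (normalize c)) <=
  (\sum_(i < l) w i) * (mass c - 1).
Proof.
move=> M1 Lc; have M0 : 0 < mass c by lra.
have -> : weigh (mean (normalize c)) = weigh (mean c) / mass c.
  by rewrite /weigh mulr_suml; apply: eq_bigr => i _;
    rewrite mean_normalize mulrA.
have : weigh (mean c) / mass c <= \sum_(i < l) w i.
  rewrite ler_pdivrMr// /mass mulr_sumr; apply: ler_sum => i _.
  by rewrite ler_wpM2r// (andP (mean01 i Lc)).1.
move=> /(ler_wpM2r (_ : 0 <= mass c - 1)); rewrite subr_ge0 => /(_ M1).
by rewrite mulrBr divfK ?gt_eqF// mulr1.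
Qed.

(** * Serving a Lipschitz cost by raising and evicting *)

Section Request.
Variables (r : 'I_l) (g : R -> R).
Hypothesis g_cost : lip_cost (w r) g.

Definition raise_row c : state :=
  fun i => if i == r then raise g (w r) (c r) else c i.

Lemma raise_row_layered c : layered c -> layered (raise_row c).
Proof.
move=> Lc i h; case: g_cost => _ gm gl _.
rewrite /raise_row; case: eqP => // _; split.
  by apply: raise01 => // k; case: (Lc r k).
by apply: raise_mono => // k; case: (Lc r k).
Qed.

Lemma raise_row_ge c i h : layered c -> c i h <= raise_row c i h.
Proof.
move=> Lc; case: g_cost => _ gm gl _.
rewrite /raise_row; case: eqP => // ->.
by apply: raise_ge => // k; case: (Lc r k).
Qed.

Lemma total_excess_raise c y : layered c -> 0 <= y r <= 1 ->
  total_excess (raise_row c) y - total_excess c y <= g (y r).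
Proof.
move=> Lc yr; case: g_cost => g0 gm gl _.
rewrite (@sum_update _ _ r) => [|i /negPf ir]; last by rewrite /raise_row ir.
rewrite /raise_row eqxx -mulrBr.
by apply: excess_raise => // k; case: (Lc r k).
Qed.

Lemma total_deficit_raise c y : layered c -> 0 <= y r <= 1 ->
  g (mean c r) - g (y r) <=
  2 * (total_deficit c y - total_deficit (raise_row c) y).
Proof.
move=> Lc yr; case: g_cost => g0 gm gl gc.
rewrite (@sum_update _ _ r) => [|i /negPf ir]; last by rewrite /raise_row ir.
rewrite /raise_row eqxx -mulrBr.
by apply: deficit_raise => // k; case: (Lc r k).
Qed.

(** Raise, evict, normalize. In the raise, [- weigh] cancels the movement, twice the deficit pays
    [g (mean c r)] up to one [g (y r)], and the excess adds at most [12 * g (y r)]. The eviction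
    costs nothing after amortization. *)
Lemma slice c (e : R) : layered c -> mass c = 1 -> 0 < e ->
  exists c', [/\ layered c', mass c' = 1, mean c r <= mean c' r &
    forall y, in_simplex y ->
      move_cost w (mean c) (mean c') + g (mean c r)
        + potential c' y - potential c y <= 13 * g (y r) + e].
Proof.
move=> Lc Mc e0.
pose Ws := \sum_(i < l) w i; have Ws0 : 0 < Ws := wsum_gt0.
(* Normalizing loses at most [Ws * d] of weighted mean, counted 1 + 2 + 1 times: as movement, in
   twice the deficit and in [- weigh]. *)
pose d := Num.min 1 (e / (4 * Ws)).
have d01 : 0 < d <= 1 by rewrite lt_min ltr01 divr_gt0 ?mulr_gt0// ge_min lexx.
have dW : 4 * (Ws * d) <= e.
  by rewrite mulrA mulrC -ler_pdivlMr ?mulr_gt0// ge_min lexx orbT.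
pose c1 := raise_row c.
have L1 : layered c1 := raise_row_layered Lc.
have le1 i : mean c i <= mean c1 i by apply: mean_le => // j h _;
  apply: raise_row_ge.
have M1 : 1 <= mass c1 by rewrite -Mc; apply: ler_sum.
have [c2 [[L2 le2 d2] M2 M2e]] := evict_until L1 d01 M1.
pose c3 := normalize c2.
have L3 : layered c3 := normalize_layered M2 L2.
have le3 i h : c3 i h <= c2 i h by apply: normalize_le.
have m2 i : mean c2 i <= mean c1 i by apply: mean_le.
have m3 i : mean c3 i <= mean c2 i by apply: mean_le => // j h _; apply: le3.
have M3 : mass c3 = 1 by apply: mass_normalize; lra.
have w3 := weigh_normalize M2 L2; rewrite -/c3 -/Ws in w3.
have w3' : 4 * (weigh (mean c2) - weigh (mean c3)) <= e.
  apply: le_trans dW; rewrite ler_pM2l//; apply: le_trans w3 _.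
  by rewrite ler_pM2l//; lra.
exists c3; split=> //.
  (* The mass is unchanged and no other row has grown, so row [r] has not shrunk. *)
  have : mass c - mass c3 = 0 by rewrite Mc M3 subrr.
  rewrite /mass (bigD1 r)//= [X in _ - X](bigD1 r)//=.
  suff : \sum_(i < l | i != r) mean c3 i <= \sum_(i < l | i != r) mean c i
    by lra.
  apply: ler_sum => i ir; rewrite (le_trans (m3 i))// (le_trans (m2 i))//.
  by rewrite /mean /c1 /raise_row (negPf ir).
move=> y yD; have yr := yD.1 r.
have A1 := total_excess_raise Lc yr.
have A2 := total_deficit_raise Lc yr.
have A3 := d2 y yD.
have A4 : total_excess c3 y <= total_excess c2 y
  by apply: total_excess_mono => i h _.
have A5 := total_deficit_drop y le2.
have A6 : total_deficit c3 y - total_deficit c2 y <=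
          weigh (mean c2) - weigh (mean c3)
            by apply: total_deficit_drop => i h _.
have T1 := move_cost_triangle (mean c) (mean c1) (mean c3).
have T2 := move_cost_triangle (mean c1) (mean c2) (mean c3).
rewrite (move_cost_le le1) in T1.
rewrite (move_cost_sym (mean c1) (mean c2)) (move_cost_le m2) in T2.
rewrite (move_cost_sym (mean c2) (mean c3)) (move_cost_le m3) in T2.
by rewrite /potential; rewrite -/c1 in A1 A2; lra.
Qed.

(** Service is paid only at the final position. The mean of row [r] never decreases, so this costs
    at most what the slices charged at their starting positions. *)
Lemma slices c n (e : R) : layered c -> mass c = 1 -> 0 < e ->
  exists c', [/\ layered c', mass c' = 1, mean c r <= mean c' r &
    forall y, in_simplex y ->
      move_cost w (mean c) (mean c') + n%:R * g (mean c' r)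
        + potential c' y - potential c y <= 13 * (n%:R * g (y r)) + n%:R * e].
Proof.
move=> Lc Mc e0; elim: n => [|n [c1 [L1 M1 le1 H1]]].
  exists c; split=> // y yD.
  rewrite !mul0r mulr0 !addr0 -addrA subrr addr0.
  by rewrite /move_cost big1// => i _; rewrite subrr normr0 mulr0.
have [c2 [L2 M2 le2 H2]] := slice L1 M1 e0.
exists c2; split=> //; first exact: le_trans le2.
move=> y yD; have := H1 y yD; have := H2 y yD.
have := move_cost_triangle (mean c) (mean c1) (mean c2).
have /andP[a0 _] := mean01 r L1.
have /andP[_ a1] := mean01 r L2.
case: g_cost => _ gm _ _; have gg := gm _ _ a0 le2 a1.
have : n%:R * g (mean c2 r) <= n%:R * g (mean c1 r) by rewrite ler_wpM2l.
rewrite -natr1 !mulrDl !mul1r; lra.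
Qed.

End Request.

(** * Lipschitz bounds for the potential, and direct jumps *)

(* Bounds movement plus change of potential per unit of mass moved to a row. *)
Definition jump_rate : R := (12 * m.+1%:R + 4) * (\sum_(i < l) w i) / p m.

Lemma avg_lip (u v : nat -> R) (D : R) :
  (forall h, (h <= m)%N -> `|u h - v h| <= D) -> `|avg p m u - avg p m v| <= D.
Proof.
move=> uv; rewrite /avg -sumrB -[leRHS](avg_const p_sum1).
apply: le_trans (ler_norm_sum _ _ _) _; apply: ler_sum => h _.
by rewrite -mulrBr normrM gtr0_norm// ler_pM2l// uv// -ltnS.
Qed.

Lemma excess_lip (u v : nat -> R) (y z D : R) :
  (forall h, (h <= m)%N -> `|u h - y - (v h - z)| <= D) ->
  excess m u y - excess m v z <= m.+1%:R * D.
Proof.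
move=> uv; rewrite /excess -sumrB mulr_natl.
apply: (@le_trans _ _ (\sum_(h < m.+1) D)); last by rewrite sumr_const card_ord.
apply: ler_sum => h _; apply: le_trans (ler_norm _) _.
by apply: le_trans (pos_lip _ _) _; rewrite uv// -ltnS.
Qed.

Lemma deficit_lip (u v : nat -> R) (y z D : R) :
  (forall h, (h <= m)%N -> `|y - u h - (z - v h)| <= D) ->
  deficit p m u y - deficit p m v z <= D.
Proof.
move=> uv; apply: le_trans (ler_norm _) _.
apply: (@avg_lip (fun h => pos (y - u h)) (fun h => pos (z - v h))) => h hm.
exact: le_trans (pos_lip _ _) (uv h hm).
Qed.

Lemma potential_lip c c' y (D : R) :
  (forall i h, (h <= m)%N -> `|c' i h - c i h| <= D) ->
  move_cost w (mean c) (mean c') + potential c' y - potential c y <=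
  (12 * m.+1%:R + 4) * (\sum_(i < l) w i) * D.
Proof.
move=> cD; set Ws := \sum_(i < l) w i.
have sumw (F : 'I_l -> R) (k : R) : (forall i, F i <= k) ->
    \sum_i w i * F i <= Ws * k.
  by move=> Fk; rewrite mulr_suml; apply: ler_sum => i _; rewrite ler_pM2l.
have mD i : `|mean c' i - mean c i| <= D by apply: avg_lip => h; apply: cD.
have H1 : move_cost w (mean c) (mean c') <= Ws * D by apply: sumw.
have H2 : total_excess c' y - total_excess c y <= Ws * (m.+1%:R * D).
  rewrite /total_excess -sumrB; under eq_bigr do rewrite -mulrBr.
  apply: sumw => i; apply: excess_lip => h hm.
  by rewrite opprB addrA subrK cD.
have H3 : total_deficit c' y - total_deficit c y <= Ws * D.
  rewrite /total_deficit -sumrB; under eq_bigr do rewrite -mulrBr.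
  apply: sumw => i; apply: deficit_lip => h hm.
  by rewrite opprB addrC addrA subrK distrC cD.
have H4 : weigh (mean c) - weigh (mean c') <= Ws * D.
  rewrite /weigh -sumrB; under eq_bigr do rewrite -mulrBr.
  by apply: sumw => i; apply: le_trans (ler_norm _) _; rewrite distrC.
rewrite /potential; lra.
Qed.

(** Mix the state with the vertex [r]. A layer is at most [(1 - mean c r) / p m] away from its
    target 0 or 1, since [p m] times that distance is at most its average over the row; hence no
    layer moves by more than [(z - mean c r) / p m]. *)
Lemma jump c r (z : R) : layered c -> mass c = 1 -> mean c r <= z <= 1 ->
  exists c', [/\ layered c', mass c' = 1, mean c' r = z &
    forall y, move_cost w (mean c) (mean c') + potential c' y - potential c y
      <= jump_rate * (z - mean c r)].
Proof.
move=> Lc Mc /andP[xz z1]; set x := mean c r in xz *.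
have rest i : i != r -> mean c i <= 1 - x.
  move=> ir; rewrite -Mc /mass (bigD1 r)//= -/x addrAC subrr add0r.
  rewrite (bigD1 i)//= lerDl sumr_ge0// => j _.
  by case/andP: (mean01 j Lc).
have [x1|x1] := leP 1 x.
  have zx : z = x by lra.
  exists c; split=> // y; rewrite zx subrr mulr0 -addrA subrr addr0.
  by rewrite /move_cost big1// => i _; rewrite subrr normr0 mulr0.
have x10 : 0 < 1 - x by lra.
pose t := (z - x) / (1 - x).
have t01 : 0 <= t <= 1.
  by rewrite divr_ge0 ?subr_ge0 ?(ltW x1)//= ler_pdivrMr//; lra.
have /andP[t0 t1] := t01.
have tx : t * (1 - x) = z - x by rewrite divfK ?gt_eqF.
pose c' i h := (1 - t) * c i h + t * (i == r)%:R.
have mc' i : mean c' i = (1 - t) * mean c i + t * (i == r)%:R.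
  by rewrite /mean avgD !avgZ (avg_const p_sum1).
exists c'; split.
- move=> i h; have [/andP[c0 c1] ci] := Lc i h; rewrite /c'; split.
    by case: eqP => _ /=; apply/andP; split; nra.
  by rewrite lerD2r ler_wpM2l// subr_ge0.
- rewrite /mass; under eq_bigr do rewrite mc'.
  rewrite big_split/= -!mulr_sumr -/(mass c) Mc (bigD1 r)//= eqxx.
  by rewrite big1 => [|i /negPf ->//] /=; ring.
- by rewrite mc' eqxx -/x /= mulr1; lra.
move=> y; apply: le_trans (potential_lip (D := (z - x) / p m) y _) _;
  last first.
  by rewrite /jump_rate le_eqVlt; apply/orP; left; apply/eqP; ring.
move=> i h hm; rewrite ler_pdivlMr//.
have -> : c' i h - c i h = t * ((i == r)%:R - c i h) by rewrite /c'; ring.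
rewrite normrM (ger0_norm t0) -tx -mulrA ler_wpM2l// mulrC.
case: eqP => [->|/eqP ir] /=.
  rewrite ger0_norm; last by case: (Lc r h) => /andP[_]; rewrite subr_ge0.
  rewrite -[X in _ <= X - _](avg_const p_sum1) -avgB.
  apply: (layer_le_avg p_gt0 p_half (u := fun h => 1 - c r h)) => // k.
  by rewrite subr_ge0; case: (Lc r k) => /andP[].
rewrite sub0r normrN ger0_norm; last by case: (Lc i h) => /andP[].
apply: le_trans (rest i ir); apply: layer_le_avg => // k.
by case: (Lc i k) => /andP[].
Qed.

(** The logarithmic factor of the competitive ratio arises here: each of the [m.+1] layers in the
    excess may change at full rate, while the deficit is an average. *)
Lemma potential_move c y z :
  potential c z - potential c y <= (12 * m.+1%:R + 2) * move_cost w y z.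
Proof.
have H2 : total_excess c z - total_excess c y <= m.+1%:R * move_cost w y z.
  rewrite /total_excess -sumrB /move_cost mulr_sumr; apply: ler_sum => i _.
  rewrite -mulrBr mulrCA ler_pM2l//; apply: excess_lip => h _.
  by rewrite opprB addrC addrA subrK distrC.
have H3 : total_deficit c z - total_deficit c y <= move_cost w y z.
  rewrite /total_deficit -sumrB /move_cost; apply: ler_sum => i _.
  rewrite -mulrBr ler_pM2l//; apply: deficit_lip => h _.
  by rewrite opprB addrA subrK.
rewrite /potential; lra.
Qed.

Lemma potential_ge c y : layered c -> - (\sum_(i < l) w i) <= potential c y.
Proof.
move=> Lc.
have H1 : 0 <= total_excess c y.
  apply: sumr_ge0 => i _; rewrite mulr_ge0 ?(ltW (w_gt0 i))//.
  by apply: sumr_ge0 => h _; apply: pos_ge0.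
have H2 : 0 <= total_deficit c y.
  apply: sumr_ge0 => i _; rewrite mulr_ge0 ?(ltW (w_gt0 i))//.
  by apply: sumr_ge0 => h _; rewrite mulr_ge0 ?pos_ge0// ltW.
have H3 : weigh (mean c) <= \sum_(i < l) w i.
  apply: ler_sum => i _; rewrite ler_piMr ?(ltW (w_gt0 i))//.
  by case/andP: (mean01 i Lc).
rewrite /potential; lra.
Qed.

Lemma jump_rate_gt0 : 0 < jump_rate.
Proof. by rewrite divr_gt0// mulr_gt0// addr_gt0// mulr_gt0. Qed.

End Eviction.

(** * The Lipschitz minorant of a convex cost *)

Section LipschitzMinorant.
Local Open Scope classical_set_scope.
Variables (R : realType) (f : R -> \bar R) (K : R).
Hypothesis f_cost : convex_cost f.
Hypothesis f1_fin : (f 1 < +oo)%E.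
Hypothesis K_ge0 : 0 <= K.
Implicit Types x v z : R.

(** The real numbers [f z + K * (z - x)] with [f z] finite, so [lip_minorant] is a one-sided infimal
    convolution; looking right is enough for a non-increasing [f]. *)
Definition shifted_values x : set R :=
  [set v | exists2 z, x <= z <= 1 & f z = (v - K * (z - x))%:E].

Definition lip_minorant x := inf (shifted_values x).

Let f_fin x t : 0 <= x <= 1 -> (f x <= t%:E)%E ->
  exists2 v : R, f x = v%:E & 0 <= v <= t.
Proof.
case: f_cost => f0 _ x01; have := f0 x x01.
by case: (f x) => [v| |]//; rewrite !lee_fin => v0 vt; exists v => //;
  apply/andP.
Qed.

Let values_lbound x : 0 <= x -> lbound (shifted_values x) 0.
Proof.
move=> x0 v [z /andP[xz z1] fz].
have : (0 <= f z)%E by case: f_cost => f0 _; rewrite f0// (le_trans x0).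
rewrite fz lee_fin => h; have : 0 <= K * (z - x) by rewrite mulr_ge0// subr_ge0.
lra.
Qed.

Let values_has_inf x : 0 <= x <= 1 -> has_inf (shifted_values x).
Proof.
move=> /andP[x0 x1]; split; last by exists 0; apply: values_lbound.
have [||v fv _] := @f_fin 1 (fine (f 1)); first by rewrite ler01 lexx.
  by rewrite fineK// ge0_fin_numE//; case: f_cost => f0 _;
    rewrite f0// ler01 lexx.
by exists (v + K * (1 - x)), 1; rewrite ?x1 ?lexx// fv addrK.
Qed.

Let minorant_le x v : 0 <= x -> shifted_values x v -> lip_minorant x <= v.
Proof. by move=> x0; apply: ge_inf; exists 0; apply: values_lbound. Qed.

Let le_minorant x t : 0 <= x <= 1 ->
  (forall v, shifted_values x v -> t <= v) -> t <= lip_minorant x.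
Proof. by move=> /values_has_inf[? _] tv; apply: lb_le_inf. Qed.

Lemma lip_minorant_le x v : 0 <= x <= 1 -> f x = v%:E -> lip_minorant x <= v.
Proof.
move=> /andP[x0 x1] fx; apply: minorant_le => //.
by exists x; rewrite ?lexx// subrr mulr0 subr0.
Qed.

Lemma lip_minorant_approx x (e : R) : 0 <= x <= 1 -> 0 < e ->
  exists z v, [/\ x <= z <= 1, f z = v%:E & v + K * (z - x) <= lip_minorant x
    + e].
Proof.
move=> x01 e0; have [v [z xz fz] /ltW ve] :=
  inf_adherent e0 (values_has_inf x01).
by exists z, (v - K * (z - x)); rewrite subrK.
Qed.

(** For monotonicity and the Lipschitz bound, a competitor [z] for one point serves the other, or is
    replaced by [b] itself when [z < b]. For convexity, near minimizers are combined. *)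
Lemma lip_minorant_cost : lip_cost K lip_minorant.
Proof.
have [f0 [fmono fconv]] := f_cost.
split.
- by move=> a a01; apply: le_minorant => // v; apply: values_lbound;
  case/andP: a01.
- move=> a b a0 ab b1; apply: le_minorant => [|v [z /andP[az z1] fz]].
    by rewrite a0 (le_trans ab).
  have b0 := le_trans a0 ab.
  have [bz|/ltW zb] := leP b z.
    apply: (@le_trans _ _ (v - K * (b - a))); last first.
      by rewrite gerBl mulr_ge0// subr_ge0.
    apply: minorant_le => //; exists z; rewrite ?bz// fz; congr _%:E; ring.
  have [||t fb /andP[_ tv]] := @f_fin b (v - K * (z - a)); first by rewrite b0.
    by rewrite -fz fmono ?b0 ?b1 ?z1// (le_trans a0).
  apply: (@le_trans _ _ t); first by apply: lip_minorant_le; rewrite ?b0.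
  by apply: le_trans tv _; rewrite gerBl mulr_ge0// subr_ge0.
- move=> a b a0 ab b1; rewrite lerBlDr -lerBlDl.
  apply: le_minorant => [|v [z /andP[bz z1] fz]];
    first by rewrite b1 (le_trans a0).
  rewrite lerBlDl; apply: minorant_le => //.
  by exists z; rewrite ?(le_trans ab)// fz; congr _%:E; ring.
- move=> a b t a01 b01 t01; apply/ler_addgt0Pr => e e0.
  have /andP[a0 a1] := a01; have /andP[b0 b1] := b01; have /andP[t0 t1] := t01.
  have [z1 [v1 [/andP[az1 z11] f1 h1]]] := lip_minorant_approx a01 e0.
  have [z2 [v2 [/andP[bz2 z21] f2 h2]]] := lip_minorant_approx b01 e0.
  pose z := t * z1 + (1 - t) * z2.
  have z01 : 0 <= z <= 1 by apply/andP; rewrite /z; split; nra.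
  have xz : t * a + (1 - t) * b <= z by rewrite /z; nra.
  have [|v fz /andP[_ vz]] := @f_fin z (t * v1 + (1 - t) * v2) z01.
    rewrite (le_trans (fconv z1 z2 t _ _ t01)) ?f1 ?f2//.
      by rewrite (le_trans a0).
    by rewrite (le_trans b0).
  apply: (@le_trans _ _ (v + K * (z - (t * a + (1 - t) * b)))).
    apply: minorant_le; first by nra.
    by exists z; rewrite ?xz ?(andP z01).2// fz addrK.
  have := ler_wpM2l t0 h1; have s0 : 0 <= 1 - t by lra.
  have := ler_wpM2l s0 h2; rewrite /z; lra.
Qed.

End LipschitzMinorant.

(** * Serving arbitrary convex costs, and the online strategy *)

Section Algorithm.
Local Open Scope classical_set_scope.
Variables (R : realType) (p : nat -> R) (m l : nat) (w : 'I_l -> R).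
Hypothesis p_gt0 : forall h, 0 < p h.
Hypothesis p_half : forall h, p h = 2 * p h.+1.
Hypothesis p_sum1 : \sum_(h < m.+1) p h = 1.
Hypothesis p_last : l%:R * p m <= 1.
Hypothesis w_gt0 : forall i, 0 < w i.
Hypothesis l_gt0 : (0 < l)%N.
Implicit Types (c : state R l) (y : Defs.point R l) (q : request R l).

Local Notation centre := (mean p m).
Local Notation Phi := (potential p m w).

Definition feasible c := layered c /\ mass p m c = 1.

Lemma feasible_mean c : feasible c -> in_simplex (centre c).
Proof. by move=> [Lc Mc]; split=> // i; apply: mean01. Qed.

Lemma lip_cost_scale (r : 'I_l) (F : R -> R) (K : R) (n : nat) :
  0 < K -> K / w r <= n%:R -> lip_cost K F -> lip_cost (w r) (fun a =>
    F a / n%:R).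
Proof.
move=> K0 Kn [F0 F1 F2 F3].
have n0 : 0 < n%:R :> R by apply: lt_le_trans Kn; rewrite divr_gt0.
have Kw : K <= w r * n%:R by rewrite mulrC -ler_pdivrMr.
split.
- by move=> a a01; rewrite divr_ge0 ?F0// ltW.
- by move=> a b *; rewrite ler_pM2r ?invr_gt0// F1.
- move=> a b a0 ab b1; rewrite -mulrBl ler_pdivrMr//.
  apply: le_trans (F2 a b a0 ab b1) _; rewrite mulrAC ler_wpM2r// subr_ge0//.
- move=> a b t *; rewrite !mulrA -mulrDl ler_pM2r ?invr_gt0//; exact: F3.
Qed.

(** After the slices, the jump goes to a near minimizer [z] for the minorant at the current mean. As
    [K] is the jump rate, the term [K * (z - x)] contained in the minorant pays for the jump and
    [f z] for the service. *)
Lemma serve_request c q (e : R) : feasible c -> convex_cost q.2 -> 0 < e ->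
  exists c', feasible c' /\ forall y, in_simplex y ->
    ((move_cost w (centre c) (centre c'))%:E + q.2 (centre c' q.1) <=
     13%:E * q.2 (y q.1) + (Phi c y - Phi c' y + e)%:E)%E.
Proof.
case: q => r f /= [Lc Mc] f_cost e0.
have [f0 [fmono fconv]] := f_cost.
(* If [f 1] is infinite, so is [f] on all of [0,1], and staying put suffices. *)
have [f1_fin|] := ltP (f 1) +oo%E; last first.
  rewrite leye_eq => /eqP f1; exists c; split=> // y [y01 _].
  suff -> : f (y r) = +oo%E by rewrite gt0_muley ?lte_fin// addye// leey.
  apply/eqP; rewrite -leye_eq -f1; have /andP[a b] := y01 r.
  by apply: fmono; rewrite ?y01 ?ler01 ?lexx.
pose K := jump_rate p m w.
have K0 : 0 < K by apply: jump_rate_gt0.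
pose n := Num.bound (K / w r).
have Kn : K / w r < n%:R by apply: archi_boundP; rewrite divr_ge0 ?ltW.
have n0 : 0 < n%:R :> R by apply: lt_trans Kn; rewrite divr_gt0.
have L_cost := lip_minorant_cost f_cost f1_fin (ltW K0).
set L := lip_minorant f K in L_cost.
have g_cost := lip_cost_scale K0 (ltW Kn) L_cost.
(* Half of the error is spread over the [n] slices; the other half goes to the choice of [z]. *)
have e1_gt0 : 0 < e / 2 / n%:R by rewrite !divr_gt0.
have [c1 [L1 M1 _ H1]] :=
  slices p_gt0 p_half p_sum1 p_last w_gt0 l_gt0 g_cost n Lc Mc e1_gt0.
have e2 : 0 < e / 2 by rewrite divr_gt0.
have m01 := mean01 p_gt0 p_sum1 r L1.
have [z [v [/andP[xz z1] fz vz]]] :=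
  lip_minorant_approx f_cost f1_fin (ltW K0) m01 e2.
have xz1 : centre c1 r <= z <= 1 by rewrite xz.
have [c2 [L2 M2 m2 H2]] := jump p_gt0 p_half p_sum1 w_gt0 L1 M1 xz1.
exists c2; split=> // y yD; have y01 := yD.1 r.
rewrite m2 fz; have := f0 _ y01; case fy : (f (y r)) => [u| |]// _; last first.
  by rewrite gt0_muley ?lte_fin// addye// leey.
rewrite -!EFinM -!EFinD lee_fin.
have Lu : L (y r) <= u := lip_minorant_le f_cost (ltW K0) y01 fy.
have := H1 y yD; rewrite !(mulrCA n%:R) !divff ?gt_eqF// !mulr1.
have := H2 y; have := move_cost_triangle w_gt0 (centre c) (centre c1) (centre
  c2).
rewrite -/K; move: vz; rewrite -/L; lra.
Qed.

(** The error allowed at time [t] is [2^-t], so that errors stay bounded over any sequence.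
    Feasibility is demanded for illegal requests too, as [competitive] wants simplex points on every
    input. *)
Definition serves (x : nat * state R l * request R l) c' := feasible c' /\
  (convex_cost x.2.2 -> forall y, in_simplex y ->
   ((move_cost w (centre x.1.2) (centre c'))%:E + x.2.2 (centre c' x.2.1) <=
    13%:E * x.2.2 (y x.2.1) +
    (Phi x.1.2 y - Phi c' y + 2^-1 ^+ x.1.1)%:E)%E).

(** The successor state is found before the offline point [y] is quantified, so choice gives a
    function of time, state and request only. *)
Lemma serving_strategy :
  exists step, forall x, feasible x.1.2 -> serves x (step x).
Proof.
suff /choice[step H] : forall x, exists c', feasible x.1.2 -> serves x c'.
  by exists step.
move=> [[t c] q].
have [Fc|nFc] := pselect (feasible c); last by exists c.
have [qc|nqc] := pselect (convex_cost q.2); last by exists c.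
have e0 : 0 < 2^-1 ^+ t :> R by rewrite exprn_gt0// invr_gt0.
by have [c' [Fc' H]] := serve_request Fc qc e0; exists c'.
Qed.

Definition constant_state y : state R l := fun i _ => y i.

Lemma mean_constant_state y : centre (constant_state y) = y.
Proof. by apply: funext => i; rewrite /mean avg_const. Qed.

Lemma feasible_constant_state y : in_simplex y -> feasible (constant_state y).
Proof.
move=> [y01 y1]; split; first by move=> i h; split; rewrite ?y01.
by rewrite /mass mean_constant_state.
Qed.

Lemma vertex_in_simplex i0 : in_simplex (fun i : 'I_l => (i == i0)%:R : R).
Proof.
split=> [i|]; first by case: eqP => _ /=; rewrite ?lexx ?ler01.
by rewrite (bigD1 i0)//= eqxx big1 ?addr0// => i /negPf ->.
Qed.

Lemma total_cost_ge0 reqs n (X : nat -> Defs.point R l) :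
  valid_requests reqs n -> (forall t, in_simplex (X t)) ->
  (0 <= total_cost w reqs n X)%E.
Proof.
move=> Vn XD; rewrite /total_cost big_seq_cond; apply: sume_ge0 => t.
rewrite andbT mem_index_iota => /andP[_ tn]; apply: adde_ge0.
  by rewrite lee_fin sumr_ge0// => i _; rewrite mulr_ge0// ltW.
by have [f0 _] := Vn t tn; apply: f0; apply: (XD t.+1).1.
Qed.

Lemma total_cost_recr reqs n X : total_cost w reqs n.+1 X =
  (total_cost w reqs n X +
    ((move_cost w (X n) (X n.+1))%:E + (reqs n).2 (X n.+1 (reqs n).1)))%E.
Proof. by rewrite /total_cost big_nat_recr. Qed.

(** * Running the strategy and amortizing its cost *)

Section Run.
Variable step : nat * state R l * request R l -> state R l.
Hypothesis step_spec : forall x, feasible x.1.2 -> serves x (step x).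

Definition run c (s : seq (request R l)) : nat * state R l :=
  foldl (fun tc q => (tc.1.+1, step (tc, q))) (0%N, c) s.

Lemma run_rcons c s q :
  run c (rcons s q) = ((run c s).1.+1, step (run c s, q)).
Proof. by rewrite /run foldl_rcons. Qed.

Lemma run_size c s : (run c s).1 = size s.
Proof.
by elim/last_ind: s => // s q IH; rewrite run_rcons size_rcons /= IH.
Qed.

Lemma run_feasible c s : feasible c -> feasible (run c s).2.
Proof.
by move=> Fc; elim/last_ind: s => // s q IH; rewrite run_rcons /=;
  case: (step_spec (x := (run c s, q)) IH).
Qed.

(* online_alg must answer with simplex points even from an illegal x0. *)
Definition start y : Defs.point R l :=
  if `[< in_simplex y >] then y else fun i => (i == Ordinal l_gt0)%:R.

Lemma start_in_simplex y : in_simplex (start y).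
Proof. by rewrite /start; case: asboolP => // _; apply: vertex_in_simplex. Qed.

Definition algorithm : online_alg R l :=
  fun x0 s => centre (run (constant_state (start x0)) s).2.

Lemma algorithm_in_simplex x0 s : in_simplex (algorithm x0 s).
Proof.
apply: feasible_mean; apply: run_feasible; apply: feasible_constant_state.
exact: start_in_simplex.
Qed.

Variables (rho : R) (x0 : Defs.point R l) (reqs : nat -> request R l).
Hypothesis rho_ge13 : 13 <= rho.
Hypothesis rho_ge_lip : 12 * m.+1%:R + 2 <= rho.
Hypothesis x0D : in_simplex x0.

Let rho_gt0 : 0 < rho.
Proof. by apply: lt_le_trans rho_ge13; rewrite ltr0n. Qed.

Let c_ t := (run (constant_state x0) [seq reqs i | i <- iota 0 t]).2.

Let c_S t : c_ t.+1 = step ((t, c_ t), reqs t).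
Proof.
rewrite /c_ -addn1 iotaD map_cat cats1 run_rcons/= add0n; congr step.
by congr (_, _); rewrite [LHS]surjective_pairing run_size size_map size_iota.
Qed.

Let c_feasible t : feasible (c_ t).
Proof. exact/run_feasible/feasible_constant_state. Qed.

Let alg_trajE : alg_traj algorithm x0 reqs = fun t => centre (c_ t).
Proof.
have sE : start x0 = x0 by rewrite /start asboolT.
by apply: funext => -[|t]; rewrite /= /algorithm ?sE ?mean_constant_state.
Qed.

(** Each step adds the service inequality and the bound on the potential when the offline point
    moves; [2 - 2 * 2^-n] is the sum of the first [n] errors. *)
Lemma amortized X n : X 0%N = x0 -> (forall t, in_simplex (X t)) ->
  valid_requests reqs n ->
  (total_cost w reqs n (fun t => centre (c_ t)) + (Phi (c_ n) (X n))%:E <=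
   rho%:E * total_cost w reqs n X +
   (Phi (c_ 0%N) x0 + 2 - 2 * 2^-1 ^+ n)%:E)%E.
Proof.
move=> X0 XD; elim: n => [|n IH] Vn.
  rewrite /total_cost !big_geq// mule0 !add0e X0 lee_fin expr0; lra.
have Vn' : valid_requests reqs n by move=> t /ltnW tn; apply: Vn.
have {IH} := IH Vn'; rewrite !total_cost_recr.
have T0 := total_cost_ge0 Vn' (fun t => feasible_mean (c_feasible t)).
have U0 := total_cost_ge0 Vn' XD.
have qc := Vn n (ltnSn n).
have := (step_spec (x := ((n, c_ n), reqs n)) (c_feasible n)).2 qc _ (XD n.+1).
rewrite -c_S /=.
have a0 := qc.1 _ ((feasible_mean (c_feasible n.+1)).1 (reqs n).1).
have b0 := qc.1 _ ((XD n.+1).1 (reqs n).1).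
have rho0 : (0 < rho%:E)%E by rewrite lte_fin.
have mU0 : (0 <= (move_cost w (X n) (X n.+1))%:E)%E.
  by rewrite lee_fin sumr_ge0// => i _; rewrite mulr_ge0// ltW.
move: b0; case: ((reqs n).2 (X n.+1 _)) => [b| |]// b0; last first.
  move=> _ _; rewrite [((_)%:E + +oo)%E]addey// addey; last first.
    by apply: contraTneq U0 => ->.
  by rewrite gt0_muley// addye// leey.
move: a0; case: ((reqs n).2 (centre _ _)) => [a| |]// a0.
move: U0; case: (total_cost w reqs n X) => [U| |]// U0; last first.
  by rewrite addye ?gt0_muley ?addye ?leey.
move: T0; case: (total_cost w reqs n _) => [T| |]// T0.
rewrite -!(EFinD, EFinM) !lee_fin => H1 H2.
have H3 := potential_move p_gt0 p_sum1 w_gt0 (c_ n) (X n) (X n.+1).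
rewrite !lee_fin in mU0 b0.
have H4 := ler_wpM2r b0 rho_ge13.
have H5 := ler_wpM2r mU0 rho_ge_lip.
rewrite exprS; lra.
Qed.

Lemma algorithm_bound n : valid_requests reqs n ->
  (total_cost w reqs n (alg_traj algorithm x0 reqs) <=
   rho%:E * OPT w x0 reqs n +
   (Phi (constant_state x0) x0 + 2 + \sum_(i < l) w i)%:E)%E.
Proof.
(* Solved for [OPT], the claim is a lower bound on the infimum, checked on each offline
   trajectory. *)
move=> Vn; rewrite alg_trajE -leeBlDr// -lee_pdivrMl//.
apply: le_ereal_inf_tmp => _ [X [X0 XD] <-].
rewrite lee_pdivrMl//.
rewrite leeBlDr//; have := amortized X0 XD Vn.
have P0 := potential_ge p_gt0 p_sum1 w_gt0 (X n) (c_feasible n).1.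
rewrite -leeBrDr// => /le_trans; apply; rewrite -addeA leeD2l//.
rewrite -EFinB lee_fin.
have : 0 <= 2^-1 ^+ n :> R by rewrite exprn_ge0// invr_ge0.
have -> : c_ 0%N = constant_state x0 by [].
lra.
Qed.

End Run.
End Algorithm.

(** * Choice of the weights and of the constant *)

Lemma geometric_weights (R : realType) (m : nat) : exists p : nat -> R,
  [/\ forall h, 0 < p h, forall h, p h = 2 * p h.+1,
      \sum_(h < m.+1) p h = 1 & p m <= (2 ^+ m)^-1].
Proof.
set S : R := \sum_(h < m.+1) (2 ^+ h)^-1.
have t0 h : 0 < (2 ^+ h)^-1 :> R by rewrite invr_gt0 exprn_gt0.
have S1 : 1 <= S.
  rewrite /S big_ord_recl expr0 invr1 lerDl sumr_ge0// => h _; exact: ltW.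
have S0 : 0 < S by lra.
exists (fun h => (2 ^+ h)^-1 / S); split.
- by move=> h; rewrite divr_gt0.
- by move=> h; rewrite exprS; field; rewrite expf_neq0//= gt_eqF.
- by rewrite -mulr_suml divff// gt_eqF.
- by rewrite ler_pdivrMr// ler_peMr// ltW.
Qed.

(** The left side is [12 * (m - 1) + 37]. Here [(m - 1) * ln 2] is at most [ln (l + 1)] because
    [2 ^ (m - 1) < l], and [ln 2 <= ln (l + 1)]; 49 is 12 + 37. *)
Lemma up_log_le_ln (R : realType) (l : nat) : (2 <= l)%N ->
  12 * (up_log 2 l).+1%:R + 13 <= 49 / ln 2 * ln (l.+1)%:R :> R.
Proof.
move=> l2; set m := up_log 2 l.
have ln2_gt0 : 0 < ln 2 :> R by rewrite ln_gt0 ?ltr1n.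
have ln2_le : ln 2 <= ln (l.+1)%:R :> R
  by rewrite ler_ln ?posrE ?ltr0n// ler_nat ltnW.
have mE : m = m.-1.+1 by rewrite prednK// up_log_gt0.
have /andP[lt_l _] : (2 ^ m.-1 < l <= 2 ^ m)%N by apply: up_log_bounds.
have : m.-1%:R * ln 2 <= ln (l.+1)%:R :> R.
  rewrite mulr_natl -lnXn// ler_ln ?posrE ?exprn_gt0 ?ltr0n//.
  by rewrite -natrX ler_nat ltnW// ltnS ltnW.
have -> : m.-1%:R = m%:R - 1 :> R by rewrite {2}mE -natr1 addrK.
rewrite mulrAC ler_pdivlMr// -natr1; lra.
Qed.

Theorem theorem4 (R : realType) :
  exists c : R, 0 < c /\
  forall (l : nat) (w : 'I_l -> R), (2 <= l)%N -> (forall i, 0 < w i) ->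
  exists A : online_alg R l, competitive w A (c * ln (l.+1)%:R).
Proof.
have ln2_gt0 : 0 < ln 2 :> R by rewrite ln_gt0 ?ltr1n.
exists (49 / ln 2); split=> [|l w l2 w_gt0]; first by rewrite divr_gt0.
set m := up_log 2 l.
have l_gt0 : (0 < l)%N by apply: leq_trans l2.
have [p [p_gt0 p_half p_sum1 p_m]] := geometric_weights R m.
have p_last : l%:R * p m <= 1.
  apply: (@le_trans _ _ (2 ^+ m * (2 ^+ m)^-1)); last first.
    by rewrite divff ?expf_neq0.
  by rewrite ler_pM ?(ltW (p_gt0 m))// -natrX ler_nat up_logP.
have [step step_spec] :=
  serving_strategy p_gt0 p_half p_sum1 p_last w_gt0 l_gt0.
exists (algorithm p m l_gt0 step); split.
  by move=> x0 s; apply: algorithm_in_simplex step_spec _ _.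
have rho := up_log_le_ln R l2; rewrite -/m in rho.
(* The additive constant is fixed before the requests are introduced, hence cannot depend on
   them. *)
move=> x0 x0D; eexists => reqs n Vn.
apply: (algorithm_bound p_gt0 p_sum1 w_gt0 l_gt0 step_spec _ _ x0D Vn).
- by have : 0 <= m.+1%:R :> R by []; lra.
- lra.
Qed.
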